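(* If a space $X$ has the homotopy type of a finite polyhedron, then $\mathrm{ct}(X)=\Delta^{\simeq}(X)$.
   Context: An open cover $\mathcal U$ of a space $Y$ is a good cover if all elements of $\mathcal U$ and all their non-empty finite intersections are contractible. The strict covering type $\mathrm{sct}(Y)$ is the minimal cardinality of a good cover of $Y$. The covering type of $X$ is $\mathrm{ct}(X):=\min\{\mathrm{sct}(Y)\mid Y\simeq X\}$, where $\simeq$ denotes homotopy equivalence (the minimum is over spaces $Y$ homotopy equivalent to $X$ that admit a finite good cover). For a compact polyhedron $P$, $\Delta(P)$ is the minimal number of vertices of a simplicial complex $K$ whose geometric realization $|K|$ is homeomorphic to $P$. Finally $\Delta^{\simeq}(X):=\min\{\Delta(P)\mid P\simeq X\}$, where $P$ ranges over compact polyhedra homotopy equivalent to $X$. *)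

(* Defs.v *)
From HB Require Import structures.
From mathcomp Require Import all_boot all_order all_algebra.
From mathcomp Require Import all_classical all_reals.
From mathcomp Require Import topology normedtype.

Set Implicit Arguments.
Unset Strict Implicit.
Unset Printing Implicit Defensive.

Import Order.TTheory GRing.Theory Num.Theory.
Import numFieldNormedType.Exports.

Local Open Scope classical_set_scope.
Local Open Scope ring_scope.

(* Minimum of a set of naturals in nat + {oo}; [None] stands for oo, the
   minimum of the empty set. *)
Definition min_nat (S : set nat) : option nat :=
  if pselect (exists n, n \in S) is left h then Some (ex_minn h) else None.

Lemma min_natP (S : set nat) (n : nat) :
  min_nat S = Some n <-> S n /\ forall m, S m -> (n <= m)%N.
Proof.
rewrite /min_nat; case: pselect => [h|h]; last first.
  by split => // -[Sn _]; case: h; exists n; exact/mem_set.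
case: ex_minnP => k /set_mem Sk kmin; split.
  by move=> [<-]; split => // m Sm; exact/kmin/mem_set.
move=> [Sn nmin]; congr Some; apply/eqP.
by rewrite eqn_leq nmin // andbT; exact/kmin/mem_set.
Qed.

Section Homotopy.
Variable R : realType.

Definition homotopic (X Y : topologicalType) (f g : X -> Y) : Prop :=
  exists H : X * R -> Y,
    [/\ {within [set: X] `*` `[0, 1], continuous H},
        forall x, H (x, 0) = f x & forall x, H (x, 1) = g x].

Definition homotopy_equivalent (X Y : topologicalType) : Prop :=
  exists (f : X -> Y) (g : Y -> X),
    [/\ continuous f, continuous g,
        homotopic (g \o f) idfun & homotopic (f \o g) idfun].

(* The empty space is not contractible. *)
Definition contractible (X : topologicalType) : Prop :=
  exists c : X, homotopic (@idfun X) (cst c).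

End Homotopy.

Definition homeomorphic (X Y : topologicalType) : Prop :=
  exists (f : X -> Y) (g : Y -> X),
    [/\ cancel f g, cancel g f, continuous f & continuous g].

Section CoveringType.
Variable R : realType.

Definition good_cover (Y : topologicalType) (U : set (set Y)) : Prop :=
  [/\ forall A, U A -> open A,
      \bigcup_(A in U) A = [set: Y],
      forall A, U A -> contractible R (set_type A) &
      forall F : set (set Y), F `<=` U -> finite_set F -> F !=set0 ->
        \bigcap_(A in F) A !=set0 ->
        contractible R (set_type (\bigcap_(A in F) A))].

Definition sct (Y : topologicalType) : option nat :=
  min_nat [set n | exists U : set (set Y), good_cover U /\ (U #= `I_n)%card].

Definition ct (X : topologicalType) : option nat :=
  min_nat [set n | exists Y : topologicalType,
    homotopy_equivalent R Y X /\ sct Y = Some n].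

End CoveringType.

(* Abstract simplicial complex with vertex set 'I_n: every element of 'I_n is
   required to be a vertex, so that n is the number of vertices. *)
Record simplicial_complex (n : nat) := SimplicialComplex {
  faces : {set {set 'I_n}};
  faces_neq0 : finset.set0 \notin faces;
  faces_vertex : forall i : 'I_n, [set i]%SET \in faces;
  faces_down : forall s t : {set 'I_n},
    s \in faces -> t \subset s -> t != finset.set0 -> t \in faces
}.

Section Polyhedra.
Variable R : realType.

(* Points are given by their barycentric coordinates; for finitely many
   vertices the weak topology is the one induced from R^n. *)
Definition realization_set (n : nat) (K : simplicial_complex n) :
    set 'rV[R]_n :=
  [set x | [/\ forall i, 0 <= x 0 i, \sum_i x 0 i = 1 &
               [set i | x 0 i != 0]%SET \in faces K]].

Definition realization (n : nat) (K : simplicial_complex n) :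
    topologicalType :=
  set_type (realization_set K).

(* A polyhedron is compact if and only if its triangulations are finite. *)
Definition compact_polyhedron (P : topologicalType) : Prop :=
  exists (n : nat) (K : simplicial_complex n), homeomorphic (realization K) P.

Definition Delta (P : topologicalType) : option nat :=
  min_nat [set n | exists K : simplicial_complex n,
    homeomorphic (realization K) P].

Definition Delta_he (X : topologicalType) : option nat :=
  min_nat [set n | exists P : topologicalType,
    [/\ compact_polyhedron P, homotopy_equivalent R P X & Delta P = Some n]].

End Polyhedra.

(* Main.v *)
Require Import Defs.
From mathcomp Require Import all_boot all_order all_algebra.
From mathcomp Require Import all_classical all_reals.
From mathcomp Require Import topology normedtype.
From mathcomp Require Import lra.

(** A complex with [n] vertices is covered by the [n] open stars of its
    vertices. The intersection of the stars of the vertices of a face [s] is the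
    set of points whose carrier contains [s]; straight segments contract it to
    a point with carrier [s]. So the stars form a good cover, and the covering
    type is at most the number of vertices of any complex homotopy equivalent
    to [X] ([open_star_good_cover], [ct_le]).

    For the converse, a good cover [U] of [Y] by [n] sets has a nerve [N] with
    [n] vertices, and [Y] has to be compared with [|N|]. The space [Y] is
    arbitrary, so it need not carry partitions of unity subordinate to [U]; but
    it is homotopy equivalent to some polyhedron [|K|], and the maps to [|N|]
    are only ever constructed on the metric spaces [|K|] and [|N| x R]
    ([nerve_theorem]).

    The map [F : |N| -> Y] ([nerve_map]) is given by contractions alone. Order
    the barycentric coordinates of [x]. The vertex sets separated from their
    complement by a definite gap in these coordinates form a chain; contract
    successively, from the largest to the smallest of them, the corresponding
    intersections of members of [U], each by an amount controlled by its gap.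
    The largest gap is large enough for the contraction to be completed, so
    that the outcome does not depend on the point of [Y] that the process
    starts from, whereas undoing all contractions leads back to this point.
    Hence [F \o t] is homotopic to [y] whenever [y z] lies in the intersection
    belonging to the carrier of [t z]. Moreover [F x] lies in [U i] as soon as
    the [i]-th coordinate of [x] is nearly maximal.

    If [h : |K| -> Y] and [k : Y -> |K|] are inverse homotopy equivalences and
    [phi : |K| -> |N|] comes from a partition of unity subordinate to the
    pulled back cover, then [F \o phi] is homotopic to [h], so that
    [g := phi \o k] is a right homotopy inverse of [F]. It is also a left one:
    the homotopy from [F \o g \o F] to [F] pulls [U] back to [|N| x R], and a
    partition of unity there yields a homotopy between maps [|N| -> |N|] that
    are connected by straight segments to [g \o F] and to the identity. *)

Set Implicit Arguments.
Unset Strict Implicit.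
Unset Printing Implicit Defensive.

Import Order.TTheory GRing.Theory Num.Theory.
Import numFieldNormedType.Exports.

Local Open Scope classical_set_scope.
Local Open Scope ring_scope.

(** * Continuity at a point *)

Section ContinuityAtPoint.
Context {T U V : topologicalType}.

Lemma continuous_at_pair (f : T -> U) (g : T -> V) x :
  {for x, continuous f} -> {for x, continuous g} ->
  {for x, continuous (fun z => (f z, g z))}.
Proof. by move=> cf cg; exact: cvg_pair. Qed.

Lemma continuous_at_near_eq (f g : T -> U) x :
  (\forall z \near x, f z = g z) ->
  {for x, continuous f} -> {for x, continuous g}.
Proof.
move=> fg cf A; rewrite -(nbhs_singleton fg) => /cf.
by apply: filterS2 fg => z /= ->.
Qed.

(** Near [x] both branches are close to their common value at [x], whichever of
    them is taken. *)
Lemma continuous_at_if (b : T -> bool) (f g : T -> U) x :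
  f x = g x -> {for x, continuous f} -> {for x, continuous g} ->
  {for x, continuous (fun z => if b z then f z else g z)}.
Proof.
move=> fgx cf cg A.
have -> : (if b x then f x else g x) = f x by case: ifP.
move=> fxA; have fA := cf _ fxA; rewrite fgx in fxA.
have gA := cg _ fxA; rewrite !nbhs_simpl /= in fA gA *.
by apply: filterS2 fA gA => z /= ? ?; case: ifP.
Qed.

Lemma continuous_at_row n (f : T -> 'rV[U]_n) x :
  (forall i, {for x, continuous (fun z => f z 0 i)}) -> {for x, continuous f}.
Proof.
move=> cf A [P fxP PA]; rewrite nbhs_simpl /=.
suff fP : \forall z \near x, forall i, P 0 i (f z 0 i).
  by apply: filterS fP => z fzP; apply: PA => i j; rewrite ord1.
apply: filter_forall => i; exact: (cf i _ (fxP 0 i)).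
Qed.

Lemma continuous_at_set_type (A : set U) (f : T -> set_type A) x :
  {for x, continuous (fun z => val (f z))} -> {for x, continuous f}.
Proof.
move=> cf B [_ [[C openC <-] Cx] CB]; rewrite nbhs_simpl /=.
have fC := cf _ (open_nbhs_nbhs (conj openC Cx)).
rewrite nbhs_simpl /= in fC.
by apply: filterS fC => z Cz; apply: CB.
Qed.

Lemma continuous_set_val (A : set U) : continuous (val : set_type A -> U).
Proof. exact: initial_continuous. Qed.

End ContinuityAtPoint.

Section RealFunctions.
Context {R : realType} {T : topologicalType}.

Lemma near_lt (f : T -> R) x c :
  {for x, continuous f} -> f x < c -> \forall z \near x, f z < c.
Proof. by move=> cf; exact: cvgr_lt. Qed.

Lemma near_gt (f : T -> R) x c :
  {for x, continuous f} -> c < f x -> \forall z \near x, c < f z.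
Proof. by move=> cf; exact: cvgr_gt. Qed.

Lemma continuous_at_min (f g : T -> R) x :
  {for x, continuous f} -> {for x, continuous g} ->
  {for x, continuous (fun z => Num.min (f z) (g z))}.
Proof. exact: continuous_min. Qed.

Lemma continuous_at_max (f g : T -> R) x :
  {for x, continuous f} -> {for x, continuous g} ->
  {for x, continuous (fun z => Num.max (f z) (g z))}.
Proof. exact: continuous_max. Qed.

Lemma continuous_at_sub (f g : T -> R) x :
  {for x, continuous f} -> {for x, continuous g} ->
  {for x, continuous (fun z => f z - g z)}.
Proof. exact: cvgB. Qed.

Lemma continuous_at_mul (f g : T -> R) x :
  {for x, continuous f} -> {for x, continuous g} ->
  {for x, continuous (fun z => f z * g z)}.
Proof. exact: cvgM. Qed.

Lemma continuous_at_bigmin (I : Type) (s : seq I) (P : pred I)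
    (x0 : T -> R) (F : I -> T -> R) x :
  {for x, continuous x0} -> (forall i, {for x, continuous (F i)}) ->
  {for x, continuous (fun z => \big[Num.min/x0 z]_(i <- s | P i) F i z)}.
Proof.
move=> c0 cF; elim: s => [|i s IHs].
  by under [X in {for _, continuous X}]eq_fun do rewrite big_nil.
under [X in {for _, continuous X}]eq_fun do rewrite big_cons.
by case: (P i) => //; exact: continuous_at_min.
Qed.

Lemma continuous_at_sum (I : Type) (s : seq I) (P : pred I)
    (F : I -> T -> R) x :
  (forall i, {for x, continuous (F i)}) ->
  {for x, continuous (fun z => \sum_(i <- s | P i) F i z)}.
Proof.
move=> cF; apply: cvg_big => [p|i _]; last exact: cF.
by apply: cvgD; [exact: cvg_fst|exact: cvg_snd].
Qed.

End RealFunctions.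

(** * Homotopies *)

Section Homotopies.
Context {R : realType}.

Definition clamp01 (r : R) : R := Num.max 0 (Num.min r 1).

Lemma clamp01_itv r : 0 <= clamp01 r <= 1.
Proof. by rewrite /clamp01 le_max lexx ge_max ge_min lexx ler01 orbT. Qed.

Lemma clamp01_le0 r : r <= 0 -> clamp01 r = 0.
Proof.
by move=> r0; rewrite /clamp01 min_l ?max_l // (le_trans r0 ler01).
Qed.

Lemma clamp01_ge1 r : 1 <= r -> clamp01 r = 1.
Proof. by move=> r1; rewrite /clamp01 min_r ?max_r. Qed.

Lemma continuous_clamp01 : continuous clamp01.
Proof.
move=> r.
have c1 : {for r, continuous (fun z : R => Num.min z 1)}.
  by apply: continuous_at_min; [exact: cvg_id|exact: cvg_cst].
by apply: (continuous_at_max _ c1); exact: cvg_cst.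
Qed.

(** A homotopy on [X * [0, 1]] extends to [X * R] by freezing it outside of
    [0, 1]; with globally continuous homotopies no relative topology has to be
    carried along. *)
Lemma homotopicP (X Y : topologicalType) (f g : X -> Y) :
  homotopic R f g <-> exists H : X * R -> Y,
    [/\ continuous H, forall x r, r <= 0 -> H (x, r) = f x &
        forall x r, 1 <= r -> H (x, r) = g x].
Proof.
split=> [[H [cH H0 H1]]|[H [cH H0 H1]]]; last first.
  exists H; split=> [|x|x]; [exact: continuous_subspaceT|exact: H0|exact: H1].
exists (fun p => H (p.1, clamp01 p.2)); split=> [p|x r r0|x r r1]; last 2 first.
- by rewrite /= clamp01_le0.
- by rewrite /= clamp01_ge1.
move/subspace_continuousP: cH => cH.
have kA q : ([set: X] `*` `[0, 1]) (q.1, clamp01 q.2).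
  by split => //=; rewrite in_itv /= clamp01_itv.
have ck : {for p, continuous (fun q : X * R => (q.1, clamp01 q.2))}.
  apply: continuous_at_pair; first exact: cvg_fst.
  apply: (@continuous_comp _ _ _ snd clamp01); first exact: cvg_snd.
  exact: continuous_clamp01.
apply: (@cvg_comp _ _ _ (fun q : X * R => (q.1, clamp01 q.2)) H);
  last exact: (cH _ (kA p)).
move=> A; rewrite /within /= => /ck; rewrite nbhs_simpl /=.
by apply: filterS => q /(_ (kA q)).
Qed.

Lemma homotopic_sym (X Y : topologicalType) (f g : X -> Y) :
  homotopic R f g -> homotopic R g f.
Proof.
move=> /homotopicP[H [cH H0 H1]]; apply/homotopicP.
exists (fun p => H (p.1, 1 - p.2)); split=> [p|x r r0|x r r1] /=.
- apply: (@continuous_comp _ _ _ (fun q : X * R => (q.1, 1 - q.2)) H);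
    last exact: cH.
  apply: continuous_at_pair; first exact: cvg_fst.
  by apply: cvgB; [exact: cvg_cst|exact: cvg_snd].
- by rewrite H1 //; lra.
- by rewrite H0 //; lra.
Qed.

(** Running each homotopy at triple speed puts both at rest between the times
    [1/3] and [2/3], where the two pieces are glued. *)
Lemma homotopic_trans (X Y : topologicalType) (g f h : X -> Y) :
  homotopic R f g -> homotopic R g h -> homotopic R f h.
Proof.
move=> /homotopicP[H [cH H0 H1]] /homotopicP[K [cK K0 K1]]; apply/homotopicP.
pose L (p : X * R) := H (p.1, 3 * p.2).
pose M (p : X * R) := K (p.1, 3 * p.2 - 2).
have affine (a b : R) :
    continuous (fun q : X * R => (q.1, a * q.2 + b)).
  move=> p; apply: continuous_at_pair; first exact: cvg_fst.
  apply: cvgD; last exact: cvg_cst.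
  by apply: cvgM; [exact: cvg_cst|exact: cvg_snd].
have cL : continuous L.
  move=> p; rewrite /L; under [X in continuous_at _ X]eq_fun => q
    do rewrite -[3 * _]addr0.
  exact: (continuous_comp (affine 3 0 p) (cH _)).
have cM : continuous M.
  by move=> p; exact: (continuous_comp (affine 3 (- 2) p) (cK _)).
exists (fun p => if p.2 < 2^-1 then L p else M p); split=> [p|x r r0|x r r1] /=.
- have [p2|p2] := ltP p.2 3^-1.
    apply: (@continuous_at_near_eq _ _ L) (cL p).
    apply: filterS (near_lt (f := snd) cvg_snd p2) => q q2.
    by rewrite ifT //; lra.
  have [p2'|p2'] := ltP (3^-1 * 2) p.2.
    apply: (@continuous_at_near_eq _ _ M) (cM p).
    apply: filterS (near_gt (f := snd) cvg_snd p2') => q q2.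
    by rewrite ifF //; apply: le_gtF; lra.
  apply: continuous_at_if; [|exact: cL|exact: cM].
  by rewrite /L /M H1 ?K0 //; lra.
- by rewrite ifT; [rewrite /L H0 //=; lra|lra].
- by rewrite ifF; [rewrite /M K1 //=; lra|apply: le_gtF; lra].
Qed.

Lemma homotopic_comp (W X Y Z : topologicalType) (k : W -> X) (f g : X -> Y)
    (h : Y -> Z) :
  continuous k -> continuous h -> homotopic R f g ->
  homotopic R (h \o f \o k) (h \o g \o k).
Proof.
move=> ck ch /homotopicP[H [cH H0 H1]]; apply/homotopicP.
exists (fun p => h (H (k p.1, p.2))); split=> [p|x r r0|x r r1] /=.
- apply: (@continuous_comp _ _ _ (fun q : W * R => H (k q.1, q.2)) h);
    last exact: ch.
  apply: (@continuous_comp _ _ _ (fun q : W * R => (k q.1, q.2)) H);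
    last exact: cH.
  apply: continuous_at_pair; last exact: cvg_snd.
  apply: (@continuous_comp _ _ _ fst k); [exact: cvg_fst|exact: ck].
- by rewrite H0.
- by rewrite H1.
Qed.

Lemma homotopic_precomp (W X Y : topologicalType) (k : W -> X) (f g : X -> Y) :
  continuous k -> homotopic R f g -> homotopic R (f \o k) (g \o k).
Proof.
move=> ck; apply: (homotopic_comp (h := idfun) ck) => y; exact: cvg_id.
Qed.

Lemma homotopic_eq (X Y : topologicalType) (f g : X -> Y) :
  continuous f -> f =1 g -> homotopic R f g.
Proof.
move=> cf fg; apply/homotopicP; exists (f \o fst); split=> [p|//|x r _ /=].
  by apply: continuous_comp; [exact: cvg_fst|exact: cf].
exact: fg.
Qed.

Lemma homotopy_equivalent_sym (X Y : topologicalType) :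
  homotopy_equivalent R X Y -> homotopy_equivalent R Y X.
Proof. by move=> [f [g [cf cg gf fg]]]; exists g, f; split. Qed.

Lemma homotopy_equivalent_trans (Y X Z : topologicalType) :
  homotopy_equivalent R X Y -> homotopy_equivalent R Y Z ->
  homotopy_equivalent R X Z.
Proof.
move=> [f [g [cf cg gf fg]]] [f' [g' [cf' cg' gf' fg']]].
exists (f' \o f), (g \o g'); split.
- by move=> x; apply: continuous_comp; [exact: cf|exact: cf'].
- by move=> x; apply: continuous_comp; [exact: cg'|exact: cg].
- by apply: homotopic_trans gf; exact: (homotopic_comp cf cg gf').
- by apply: homotopic_trans fg'; exact: (homotopic_comp cg' cf' fg).
Qed.

Lemma homeomorphic_homotopy_equivalent (X Y : topologicalType) :
  homeomorphic X Y -> homotopy_equivalent R X Y.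
Proof.
move=> [f [g [fK gK cf cg]]]; exists f, g; split=> //.
- apply: homotopic_eq => // x.
  by apply: continuous_comp; [exact: cf|exact: cg].
- apply: homotopic_eq => // x.
  by apply: continuous_comp; [exact: cg|exact: cf].
Qed.

End Homotopies.

(** * Maps into the realization of a complex *)

Section Realization.
Context {R : realType} {n : nat} {K : simplicial_complex n}.
Local Notation "|K|" := (realization R K).

Definition bcoord (x : |K|) (i : 'I_n) : R :=
  (val (x : set_type (@realization_set R n K)) : 'rV[R]_n) 0 i.

(** The face whose open simplex contains [x]. *)
Definition carrier (x : |K|) : {set 'I_n} := [set i | bcoord x i != 0]%SET.

Lemma realizationP (x : |K|) :
  @realization_set R n K (val (x : set_type (@realization_set R n K))).
Proof. exact: set_mem (valP x). Qed.

Lemma bcoord_ge0 x i : 0 <= bcoord x i.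
Proof. by have [+ _ _] := realizationP x; apply. Qed.

Lemma sum_bcoord x : \sum_i bcoord x i = 1.
Proof. by have [] := realizationP x. Qed.

Lemma carrier_face x : carrier x \in faces K.
Proof. by have [] := realizationP x. Qed.

Lemma face_neq0 s : s \in faces K -> exists i, i \in s.
Proof.
by move=> sK; apply/set0Pn; apply: contraNneq (faces_neq0 K) => <-.
Qed.

Lemma carrier_neq0 x : exists i, i \in carrier x.
Proof. exact/face_neq0/carrier_face. Qed.

Lemma in_carrier x i : (i \in carrier x) = (0 < bcoord x i).
Proof. by rewrite inE lt0r bcoord_ge0 andbT. Qed.

Lemma continuous_bcoord i : continuous (bcoord^~ i).
Proof.
move=> x; apply: (@continuous_comp _ _ _
  (val : set_type (@realization_set R n K) -> 'rV[R]_n) (fun M => M 0 i)).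
  exact: continuous_set_val.
exact: coord_continuous.
Qed.

Lemma bcoord_inj x y : bcoord x =1 bcoord y -> x = y.
Proof. by move=> xy; apply: val_inj; apply/rowP => i; exact: xy. Qed.

Lemma exists_bcoord_ge x : exists i, n%:R^-1 <= bcoord x i.
Proof.
apply: contrapT => /forallNP small.
have lt_small i : bcoord x i < n%:R^-1 by rewrite ltNge; exact/negP/small.
have [i0 _] := carrier_neq0 x.
suff : \sum_i bcoord x i < \sum_(i < n) n%:R^-1.
  rewrite sum_bcoord sumr_const card_ord -[X in _ < X]mulr_natl divff ?ltxx //.
  by rewrite pnatr_eq0 -lt0n (leq_ltn_trans _ (ltn_ord i0)).
by apply: ltr_sum => [|i _]; [apply/hasP; exists i0; rewrite ?mem_index_enum|].
Qed.

Section Maps.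
Context {T : topologicalType}.

Lemma continuous_at_realization (f : T -> |K|) x :
  (forall i, {for x, continuous (fun z => bcoord (f z) i)}) ->
  {for x, continuous f}.
Proof. by move=> cf; apply/continuous_at_set_type/continuous_at_row. Qed.

Lemma realization_normalize (w : T -> 'I_n -> R) :
  (forall i, continuous (w^~ i)) -> (forall z i, 0 <= w z i) ->
  (forall z, exists i, w z i != 0) ->
  (forall z, exists2 s, s \in faces K & forall i, w z i != 0 -> i \in s) ->
  exists f : T -> |K|, [/\ continuous f,
    forall z i, bcoord (f z) i = w z i / \sum_j w z j &
    forall z i, (i \in carrier (f z)) = (w z i != 0)].
Proof.
move=> cw w0 w_neq0 w_face.
have sum_gt0 z : 0 < \sum_j w z j.
  rewrite lt0r sumr_ge0 // andbT psumr_neq0 //.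
  have [i wi] := w_neq0 z; apply/hasP; exists i; first exact: mem_index_enum.
  by rewrite lt0r wi w0.
have neq0 z i : (w z i / \sum_j w z j != 0) = (w z i != 0).
  by rewrite mulf_eq0 invr_eq0 (gt_eqF (sum_gt0 z)) orbF.
have inK z : @realization_set R n K (\row_i (w z i / \sum_j w z j)).
  split=> [i||].
  - by rewrite mxE divr_ge0 // ltW.
  - under eq_bigr do rewrite mxE.
    by rewrite -mulr_suml divff // gt_eqF.
  - have [s sK sw] := w_face z.
    have [i wi] := w_neq0 z; apply: (faces_down sK).
      by apply/fintype.subsetP => j; rewrite inE mxE neq0 => /sw.
    by apply/set0Pn; exists i; rewrite inE mxE neq0.
pose f z : |K| := exist (fun y => y \in @realization_set R n K) _ (mem_set (inK z)).
have fE z i : bcoord (f z) i = w z i / \sum_j w z j by rewrite /bcoord /= mxE.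
exists f; split=> // [z|z i]; last by rewrite inE fE neq0.
apply: continuous_at_realization => i.
under [X in {for _, continuous X}]eq_fun do rewrite fE.
apply: cvgM; first exact: cw.
apply: cvgV; first by rewrite gt_eqF.
by apply: continuous_at_sum => j; exact: cw.
Qed.

End Maps.

Section Segments.
Context {T : topologicalType}.

(** Maps that share a carrier face at each point are joined by straight
    segments. *)
Lemma straight_homotopy (f g : T -> |K|) :
  continuous f -> continuous g ->
  (forall z, exists2 s, s \in faces K &
     carrier (f z) \subset s /\ carrier (g z) \subset s) ->
  exists H : T * R -> |K|,
    [/\ continuous H, forall z r, r <= 0 -> H (z, r) = f z,
        forall z r, 1 <= r -> H (z, r) = g z &
        forall z r, carrier (f z) :&: carrier (g z) \subset carrier (H (z, r))].
Proof.
move=> cf cg fg.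
pose w (p : T * R) i : R :=
  (1 - clamp01 p.2) * bcoord (f p.1) i + clamp01 p.2 * bcoord (g p.1) i.
have c01 r := andP (clamp01_itv (r : R)).
have w0 p i : 0 <= w p i.
  by have [] := c01 p.2 => c0 c1; rewrite addr_ge0 ?mulr_ge0 ?bcoord_ge0 ?subr_ge0.
have sum_w p : \sum_i w p i = 1.
  by rewrite big_split /= -!mulr_sumr !sum_bcoord !mulr1 subrK.
have cw i : continuous (w^~ i).
  move=> p.
  have cc : {for p, continuous (fun q : T * R => clamp01 q.2)}.
    by apply: (@continuous_comp _ _ _ snd clamp01);
      [exact: cvg_snd|exact: continuous_clamp01].
  have cfst (h : T -> |K|) : continuous h ->
      {for p, continuous (fun q : T * R => bcoord (h q.1) i)}.
    move=> ch; apply: (@continuous_comp _ _ _ (h \o fst) (bcoord^~ i)).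
      by apply: continuous_comp; [exact: cvg_fst|exact: ch].
    exact: continuous_bcoord.
  by apply: cvgD; apply: cvgM => //; [apply: cvgB => //; exact: cvg_cst
    |exact: cfst|exact: cfst].
have wE p i : w p i != 0 ->
    (i \in carrier (f p.1)) || (i \in carrier (g p.1)).
  apply: contraNT; rewrite negb_or !inE !negbK => /andP[/eqP f0 /eqP g0].
  by rewrite /w f0 g0 !mulr0 addr0.
have w_neq0 p : exists i, w p i != 0.
  apply: contrapT => /forallNP w_eq0; have := sum_w p.
  rewrite big1 => [/eqP|i _]; first by rewrite eq_sym oner_eq0.
  exact/eqP/negPn/negP/w_eq0.
have w_face p : exists2 s, s \in faces K & forall i, w p i != 0 -> i \in s.
  have [s sK [/fintype.subsetP fs /fintype.subsetP gs]] := fg p.1.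
  by exists s => // i /wE /orP[/fs|/gs].
have [H [cH HE suppH]] := realization_normalize cw w0 w_neq0 w_face.
have {}HE p i : bcoord (H p) i = w p i by rewrite HE sum_w divr1.
exists H; split=> // [z r r0|z r r1|z r].
- by apply: bcoord_inj => i; rewrite HE /w clamp01_le0 //= subr0 mul1r mul0r addr0.
- by apply: bcoord_inj => i; rewrite HE /w clamp01_ge1 //= subrr mul1r mul0r add0r.
- apply/fintype.subsetP => i; rewrite finset.in_setI !in_carrier HE /w /= => /andP[fi gi].
  have [] := c01 r; rewrite le_eqVlt => /predU1P[<- _|c0 c1].
    by rewrite subr0 mul1r mul0r addr0.
  by rewrite ltr_wpDl ?mulr_gt0 // mulr_ge0 ?bcoord_ge0 // subr_ge0.
Qed.

Lemma carrier_homotopic (f g : T -> |K|) :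
  continuous f -> continuous g ->
  (forall z, exists2 s, s \in faces K &
     carrier (f z) \subset s /\ carrier (g z) \subset s) ->
  homotopic R f g.
Proof.
move=> cf cg fg; have [H [cH H0 H1 _]] := straight_homotopy cf cg fg.
by apply/homotopicP; exists H.
Qed.

End Segments.
End Realization.

(** * Open stars *)

Section Stars.
Context {R : realType} {n : nat} {K : simplicial_complex n}.
Local Notation "|K|" := (realization R K).

(** Allowing any set of vertices closes the family of open stars under
    intersection. *)
Definition open_star (s : {set 'I_n}) : set |K| :=
  [set x | s \subset carrier x].

Lemma exists_carrier_eq s : s \in faces K -> exists b : |K|, carrier b = s.
Proof.
move=> sK; have [i si] := face_neq0 sK.
pose w (_ : R) j : R := (j \in s)%:R.
have wE z j : (w z j != 0) = (j \in s) by rewrite pnatr_eq0 eqb0 negbK.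
have [||||b [_ _ bE]] := @realization_normalize R n K R w.
- by move=> j; exact: cst_continuous.
- by move=> z j; rewrite ler0n.
- by move=> z; exists i; rewrite wE.
- by move=> z; exists s => // j; rewrite wE.
by exists (b 0); apply/setP => j; rewrite bE wE.
Qed.

Lemma open_open_star s : open (open_star s).
Proof.
rewrite openE => x /fintype.subsetP sx.
suff sz : \forall z \near x, forall i, i \in s -> 0 < bcoord z i.
  by apply: filterS sz => z sz; apply/fintype.subsetP => i /sz; rewrite in_carrier.
apply: (@filter_forall |K| _ (fun i z => i \in s -> 0 < bcoord z i) (nbhs x)).
move=> i; have [si|nsi] := boolP (i \in s); last exact: nearW.
have xi : 0 < bcoord x i by rewrite -in_carrier sx.
by apply: filterS (near_gt (@continuous_bcoord R n K i x) xi).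
Qed.

(** Straight segments to a point with carrier [s] stay inside the star. *)
Lemma contractible_open_star s :
  s \in faces K -> contractible R (set_type (open_star s)).
Proof.
move=> sK; have [b bs] := exists_carrier_eq sK.
pose V := set_type (open_star s).
have VP (x : V) : s \subset carrier (val x : |K|) := set_mem (valP x).
have [|||H [cH H0 H1 suppH]] :=
  @straight_homotopy R n K V (fun x => val x) (fun=> b).
- exact: continuous_set_val.
- exact: cst_continuous.
- by move=> x; exists (carrier (val x : |K|)); rewrite ?carrier_face ?bs ?VP.
have HV p : H p \in open_star s.
  case: p => x r; apply/mem_set; apply: fintype.subset_trans (suppH x r).
  by rewrite bs finset.subsetI VP subxx.
have bV : b \in open_star s by apply/mem_set; rewrite /open_star /= bs.
exists (exist (fun y => y \in open_star s) b bV); apply/homotopicP.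
exists (fun p => exist (fun y => y \in open_star s) (H p) (HV p)).
split=> [p|x r r0|x r r1]; first exact/continuous_at_set_type/cH.
- by apply: val_inj; rewrite /= H0.
- by apply: val_inj; rewrite /= H1.
Qed.

Lemma bigcap_vertex_stars (F : set (set |K|)) :
  F `<=` range (fun i => open_star [set i]%SET) ->
  \bigcap_(A in F) A = open_star [set i | `[< F (open_star [set i]%SET) >]]%SET.
Proof.
move=> FU; apply/seteqP; split=> x /=.
  move=> xF; apply/fintype.subsetP => i; rewrite inE => /asboolP /xF.
  by rewrite /open_star /= finset.sub1set.
move=> /fintype.subsetP sx A FA; have [i _ iA] := FU _ FA.
rewrite -iA /open_star /= finset.sub1set; apply: sx.
by rewrite inE; apply/asboolP; rewrite iA.
Qed.

Lemma open_star_good_cover :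
  exists U : set (set |K|), good_cover R U /\ (U #= `I_n)%card.
Proof.
exists (range (fun i => open_star [set i]%SET)); split; last first.
  rewrite (card_eqr card_II); apply: inj_card_eq => i j _ _ ij.
  have [b bi] := exists_carrier_eq (faces_vertex K i).
  have : open_star [set i]%SET b by rewrite /open_star /= bi.
  by rewrite ij /open_star /= bi finset.sub1set inE => /eqP.
split.
- by move=> _ [i _ <-]; exact: open_open_star.
- apply/seteqP; split=> // x _; have [i ix] := carrier_neq0 x.
  by exists (open_star [set i]%SET) => //; rewrite /open_star /= finset.sub1set.
- by move=> _ [i _ <-]; exact/contractible_open_star/faces_vertex.
- move=> F FU _ [A FA]; rewrite bigcap_vertex_stars // => -[x sx].
  apply: contractible_open_star; apply: faces_down (carrier_face x) sx _.
  have [i _ iA] := FU _ FA.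
  by apply/set0Pn; exists i; rewrite inE; apply/asboolP; rewrite iA.
Qed.

End Stars.

(** * Successive partial contractions *)

Section Contractions.
Context {R : realType} {Y : topologicalType}.

(** A contraction of [A] as a total function: outside of [A] it is uncontrolled,
    except that it is still the identity for nonpositive parameters and constant
    for parameters at least [1], so that a stage of a process can be switched
    off or forget its input without looking at the input. *)
Definition contracts (A : set Y) (c : Y) (H : Y * R -> Y) : Prop :=
  [/\ forall y r, A y -> {for (y, r), continuous H},
      forall y r, r <= 0 -> H (y, r) = y,
      forall y r, 1 <= r -> H (y, r) = c,
      A c & forall y r, A y -> A (H (y, r))].

Lemma open_contracts (A : set Y) :
  open A -> contractible R (set_type A) -> exists c H, contracts A c H.
Proof.
move=> oA [c /homotopicP[h [ch h0 h1]]].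
pose H (p : Y * R) : Y :=
  if pselect (A p.1) is left Ay then
    val (h (exist (fun y => y \in A) p.1 (mem_set Ay), p.2))
  else if p.2 < 1 then p.1 else val c.
have HE (a : set_type A) r : H (val a, r) = val (h (a, r)).
  rewrite /H; case: pselect => [Aa|] /=; last by move/(_ (set_mem (valP a))).
  by congr (val (h (_, _))); exact: val_inj.
have valE y : A y -> exists a : set_type A, y = val a.
  by move=> Ay; exists (exist (fun y => y \in A) y (mem_set Ay)).
exists (val c), H; split=> [_ r /valE[a ->]|y r r0|y r r1||_ r /valE[a ->]].
- move=> W; rewrite HE => /continuous_set_val /(ch (a, r)).
  move=> [[P Q] [/= [_ [[C oC <-] Ca] CP] Qr] PQW].
  exists (A `&` C, Q) => /=; first split=> //.
    by apply: open_nbhs_nbhs; split; [exact: openI|split=> //; exact: set_mem (valP a)].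
  move=> [_ q] [/= [/valE[b ->] Cb] Qq]; rewrite HE.
  by apply: (PQW (b, q)); split=> //; exact: CP.
- have [/valE[a ->]|nAy] := pselect (A y); first by rewrite HE h0.
  by rewrite /H; case: pselect => //= _; rewrite (le_lt_trans r0 ltr01).
- have [/valE[a ->]|nAy] := pselect (A y); first by rewrite HE h1.
  by rewrite /H; case: pselect => //= _; rewrite ltNge r1.
- exact: set_mem (valP c).
- by rewrite HE; exact: set_mem (valP _).
Qed.

(** In a sequence [L] of stages, [w i] is the parameter of the stage [i]; the
    stage is active if it is nonnegative, and then its input has to lie in
    [V i]. If active stages occur in the order of increasing [V], as [r]
    expresses below, this condition is inherited by the later stages. *)
Context {I : eqType} (V : I -> set Y) (c : I -> Y) (H : I -> Y * R -> Y).
Variable r : rel I.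

Definition push (w : I -> R) (L : seq I) (y : Y) : Y :=
  foldl (fun y i => H i (y, w i)) y L.

Variable L : seq I.
Hypothesis hH : forall i, i \in L -> contracts (V i) (c i) (H i).
Hypothesis rL : pairwise r L.

Lemma push_id (w : I -> R) y :
  (forall i, i \in L -> w i <= 0) -> push w L y = y.
Proof.
move: hH; elim: (L) => [//|i s IHs] hs w0 /=.
have [_ H0 _ _ _] := hs i (mem_head _ _).
rewrite /push /= H0 ?w0 ?mem_head //.
by apply: IHs => j js; [apply: hs|apply: w0]; rewrite in_cons js orbT.
Qed.

Lemma push_in (P : set Y) (w : I -> R) y :
  (forall i j, r i j -> 0 <= w i -> 0 <= w j -> V i `<=` V j) ->
  (forall i, i \in L -> 0 <= w i -> V i y /\ V i `<=` P) ->
  P y -> P (push w L y).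
Proof.
move=> rV; move: hH rL; elim: (L) y => [//|i s IHs] y hs /=.
move=> /andP[/allP ris rs] wV Py; rewrite /push /=.
have [_ H0 _ _ HV] := hs i (mem_head _ _).
have hs' j : j \in s -> contracts (V j) (c j) (H j).
  by move=> js; apply: hs; rewrite in_cons js orbT.
have wV' j : j \in s -> 0 <= w j -> V j y /\ V j `<=` P.
  by move=> js; apply: wV; rewrite in_cons js orbT.
have [wi|/ltW wi] := leP 0 (w i); last by rewrite H0 //; exact: IHs.
have [Vy VP] := wV i (mem_head _ _) wi.
apply: IHs => // [j js wj|]; last exact/VP/HV.
split; last by have [] := wV' j js wj.
by apply: (rV i j) => //; [exact: ris|exact: HV].
Qed.

Lemma push_reset i (w : I -> R) y y' :
  i \in L -> 1 <= w i -> push w L y = push w L y'.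
Proof.
move=> iL wi; have [_ _ H1 _ _] := hH iL.
by case/splitPr: iL => s t; rewrite /push !foldl_cat /= !H1.
Qed.

Context {Z : topologicalType}.

(** Where [w z i < 0] the stage [i] is the identity near [z]; elsewhere its
    input lies in the open set on which it is continuous. *)
Lemma push_continuous (w : Z -> I -> R) (y : Z -> Y) z0 :
  (forall i, continuous (w^~ i)) -> {for z0, continuous y} ->
  (forall z i j, r i j -> 0 <= w z i -> 0 <= w z j -> V i `<=` V j) ->
  (\forall z \near z0, forall i, i \in L -> 0 <= w z i -> V i (y z)) ->
  {for z0, continuous (fun z => push (w z) L (y z))}.
Proof.
move=> cw cy rV; move: hH rL; elim: (L) y cy => [//|i s IHs] y cy hs /=.
move=> /andP[/allP ris rs] nV.
have [cH H0 _ _ HV] := hs i (mem_head _ _).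
apply: (IHs (fun z => H i (y z, w z i))) => //.
- have [wi|wi] := leP 0 (w z0 i).
    apply: (@continuous_comp _ _ _ (fun z => (y z, w z i)) (H i)).
      exact: (continuous_at_pair cy (cw i z0)).
    by apply: cH; apply: (nbhs_singleton nV) wi; exact: mem_head.
  apply: continuous_at_near_eq cy.
  by apply: filterS (near_lt (cw i z0) wi) => z wz; rewrite H0 // ltW.
- by move=> j js; apply: hs; rewrite in_cons js orbT.
- apply: filterS nV => z zV j js wj.
  have [wi|/ltW wi] := leP 0 (w z i).
    apply: (rV z i j (ris _ js) wi wj).
    by apply: HV; apply: zV wi; exact: mem_head.
  by rewrite H0 //; apply: zV wj; rewrite in_cons js orbT.
Qed.

End Contractions.

(** A stage with parameter [1] forgets its input, so that the outcome is
    continuous even where the starting point jumps. *)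
Lemma push_continuous_reset (R : realType) (Y Z : topologicalType) (I : eqType)
    (V : I -> set Y) (c : I -> Y) (H : I -> Y * R -> Y) (r : rel I) (L : seq I)
    (w : Z -> I -> R) (y : Z -> Y) z0 i :
  (forall i, i \in L -> contracts (V i) (c i) (H i)) -> pairwise r L ->
  (forall j, continuous (w^~ j)) ->
  (forall z j k, r j k -> 0 <= w z j -> 0 <= w z k -> V j `<=` V k) ->
  i \in L -> (\forall z \near z0, 1 <= w z i) ->
  {for z0, continuous (fun z => push H (w z) L (y z))}.
Proof.
move=> hH rL cw rV iL w1; case/splitPr: iL hH rL => s t hH.
rewrite pairwise_cat /= => /and4P[_ _ /allP rit rt].
have [_ _ H1 Vi _] : contracts (V i) (c i) (H i).
  by apply: hH; rewrite mem_cat mem_head orbT.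
apply: (@continuous_at_near_eq _ _ (fun z => push H (w z) t (c i))).
  by apply: filterS w1 => z wz; rewrite /push foldl_cat /= H1.
apply: (push_continuous (V := V) (c := c) (r := r)) => //.
- by move=> j jt; apply: hH; rewrite mem_cat in_cons jt !orbT.
- exact: cst_continuous.
- apply: filterS w1 => z wz j jt wj.
  by apply: (rV z i j _ _ wj) => //; [exact: rit|exact: le_trans wz].
Qed.

(** * The map from the nerve *)

Section NerveMap.
Context {R : realType} {n : nat} {Y : topologicalType}.
Variables (U : 'I_n -> set Y) (N : simplicial_complex n).
Local Notation "|N|" := (realization R N).

Definition inter (s : {set 'I_n}) : set Y :=
  [set y | forall i, i \in s -> U i y].

Hypothesis openU : forall i, open (U i).
Hypothesis contrU :
  forall s, s \in faces N -> contractible R (set_type (inter s)).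

Local Notation face := {s : {set 'I_n} | s \in faces N}.

(** The amount by which the coordinates of [x] in [s] exceed both [0] and the
    coordinates outside of [s], truncated at [1]. If it is positive then [s] is
    a superlevel set of the coordinates. *)
Definition gap (s : {set 'I_n}) (x : |N|) : R :=
  \big[Num.min/1]_(i in s)
    \big[Num.min/bcoord x i]_(j | j \notin s) (bcoord x i - bcoord x j).

(** Small enough for [n] times it to be at most [n^-1], a lower bound of the
    maximal coordinate of any point. *)
Definition big_gap : R := (n.+1%:R ^+ 2)^-1.

(** The factor [3] leaves room between the gaps from which on a stage is active
    and those from which on it is completed, and again between the latter and
    [big_gap], so that some stage is completed on a neighbourhood. *)
Definition small_gap : R := big_gap / 3.

Lemma big_gap_gt0 : 0 < big_gap.
Proof. by rewrite invr_gt0 exprn_gt0 // ltr0n. Qed.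

Lemma small_gap_gt0 : 0 < small_gap.
Proof. by rewrite divr_gt0 ?big_gap_gt0. Qed.

Lemma big_gap_le1 : big_gap <= 1.
Proof. by rewrite invf_le1 ?exprn_gt0 ?ltr0n // exprn_ege1 // ler1n. Qed.

Lemma mul_big_gap_le k : (k <= n)%N -> k%:R * big_gap <= n%:R^-1.
Proof.
case: k => [|k] kn; first by rewrite mul0r invr_ge0 ler0n.
have n_gt0 : 0 < n%:R :> R by rewrite ltr0n (leq_trans _ kn).
rewrite /big_gap -[n%:R^-1]mul1r ler_pdivrMr ?exprn_gt0 ?ltr0n //.
rewrite mulrAC ler_pdivlMr // mul1r -natrX -natrM ler_nat.
by rewrite expnS expn1 leq_mul // (leq_trans kn).
Qed.

Lemma gap_geP (a : R) (s : {set 'I_n}) (x : |N|) : a <= 1 ->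
  reflect (forall i, i \in s -> a <= bcoord x i /\
             forall j, j \notin s -> a <= bcoord x i - bcoord x j)
          (a <= gap s x).
Proof.
move=> a1; rewrite /gap; apply: (iffP (bigmin_geP _ _ _ _)) => [[_ h] i si|h].
  by have /bigmin_geP[] := h i si.
by split=> // i si; apply/bigmin_geP; have [] := h i si.
Qed.

Lemma continuous_gap s : continuous (gap s).
Proof.
move=> x; apply: continuous_at_bigmin => [|i]; first exact: cst_continuous.
apply: continuous_at_bigmin => [|j]; first exact: continuous_bcoord.
by apply: continuous_at_sub; exact: continuous_bcoord.
Qed.

(** Otherwise, starting with a vertex of weight at least [n^-1], vertices could
    be added one by one, each time losing less than [big_gap] in weight, until
    there were more than [n] of them. *)
Lemma exists_big_gap x : exists2 s, s \in faces N & big_gap <= gap s x.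
Proof.
apply: contrapT => no_gap.
suff grow m : (m <= n)%N -> exists2 s : {set 'I_n}, #|s| = m.+1 &
    forall i, i \in s -> n%:R^-1 - m%:R * big_gap <= bcoord x i.
  have [s cs _] := grow n (leqnn n).
  by have := max_card (mem s); rewrite cs card_ord ltnn.
elim: m => [_|m IHm mn].
  have [i xi] := exists_bcoord_ge x.
  by exists [set i]%SET => [|j]; rewrite ?cards1 // inE => /eqP->; rewrite mul0r subr0.
have [s cs sx] := IHm (ltnW mn).
have x_ge i : i \in s -> big_gap <= bcoord x i.
  move=> si; apply: le_trans (sx i si).
  by have := mul_big_gap_le mn; rewrite -natr1 mulrDl mul1r; lra.
have sN : s \in faces N.
  apply: faces_down (carrier_face x) _ _.
    apply/fintype.subsetP => i /x_ge xi.
    by rewrite in_carrier (lt_le_trans big_gap_gt0).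
  by rewrite -card_gt0 cs.
have [i si [j nsj ij]] : exists2 i, i \in s &
    exists2 j, j \notin s & bcoord x i - bcoord x j < big_gap.
  apply: contrapT => no_edge; apply: no_gap; exists s => //.
  apply/gap_geP => [|i si]; first exact: big_gap_le1.
  split=> [|j nsj]; first exact: x_ge.
  by rewrite leNgt; apply/negP => ij; apply: no_edge; exists i => //; exists j.
exists (j |: s)%SET => [|k]; first by rewrite cardsU1 nsj cs.
rewrite in_setU1 -natr1 mulrDl mul1r => /orP[/eqP->|/sx].
  by have := sx i si; lra.
by have := big_gap_gt0; lra.
Qed.

Lemma small_gap_lt (x : |N|) : small_gap < n%:R^-1.
Proof.
have [i _] := carrier_neq0 x.
have n_gt0 : (0 < n)%N by apply: leq_ltn_trans (ltn_ord i).
have := mul_big_gap_le n_gt0; rewrite mul1r /small_gap.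
by have := big_gap_gt0; lra.
Qed.

Definition stage (x : |N|) (s : face) : R :=
  Num.min 1 (gap (val s) x / small_gap - 1).

Lemma continuous_stage s : continuous (stage^~ s).
Proof.
move=> x.
have cgap : {for x, continuous (fun z => gap (val s) z / small_gap - 1)}.
  apply: continuous_at_sub; last exact: cst_continuous.
  by apply: continuous_at_mul; [exact: continuous_gap|exact: cst_continuous].
by apply: (continuous_at_min _ cgap); exact: cst_continuous.
Qed.

Lemma stage_ge0 x s i : 0 <= stage x s -> i \in val s ->
  small_gap <= bcoord x i /\
  forall j, j \notin val s -> small_gap <= bcoord x i - bcoord x j.
Proof.
rewrite /stage le_min ler01 /= subr_ge0 ler_pdivlMr ?small_gap_gt0 // mul1r.
move=> /gap_geP; apply; rewrite /small_gap.
by have := big_gap_le1; have := big_gap_gt0; lra.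
Qed.

Lemma stage_le1 x s : stage x s <= 1.
Proof. by rewrite /stage ge_min lexx. Qed.

Lemma stage_near1 (x : |N|) : exists s, \forall z \near x, 1 <= stage z s.
Proof.
have [s sN xs] := exists_big_gap x; exists (exist _ s sN).
have : small_gap * 2 < gap s x.
  by apply: lt_le_trans xs; rewrite /small_gap; have := big_gap_gt0; lra.
move=> /(near_gt (@continuous_gap s x)); apply: filterS => z zs.
rewrite /stage le_min lexx /= lerBrDr ler_pdivlMr ?small_gap_gt0 //.
by rewrite (le_trans _ (ltW zs)) // mulrC.
Qed.

(** Superlevel sets of the same coordinates are nested. *)
Lemma stage_sub x (s t : face) : (#|val t| <= #|val s|)%N ->
  0 <= stage x s -> 0 <= stage x t -> val t \subset val s.
Proof.
move=> ts xs xt; apply/fintype.subsetP => j tj; apply: contraT => nsj.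
have /fintype.subsetPn[i si nti] : ~~ (val s \subset val t).
  apply/negP => st; move: ts; rewrite (geq_leqif (subset_leqif_card st)).
  by move=> /fintype.subsetP /(_ j tj); rewrite (negPf nsj).
have [_ /(_ _ nsj)] := stage_ge0 xs si.
have [_ /(_ _ nti)] := stage_ge0 xt tj.
by have := small_gap_gt0; lra.
Qed.

Lemma stage_carrier x s : 0 <= stage x s -> val s \subset carrier x.
Proof.
move=> xs; apply/fintype.subsetP => i /(stage_ge0 xs)[xi _].
by rewrite in_carrier (lt_le_trans small_gap_gt0).
Qed.

Lemma inter_sub (s t : {set 'I_n}) : t \subset s -> inter s `<=` inter t.
Proof. by move=> /fintype.subsetP ts y sy i /ts; exact: sy. Qed.

Lemma open_inter s : open (inter s).
Proof.
rewrite openE => y sy.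
apply: (@filter_forall Y _ (fun i z => i \in s -> U i z) (nbhs y)) => i.
have [si|nsi] := boolP (i \in s); last exact: nearW.
have := open_nbhs_nbhs (conj (openU i) (sy i si)).
by apply: filterS.
Qed.

(** The value at [x] is obtained from a point of the open set belonging to the
    carrier of [x] by contracting successively, from the largest to the
    smallest, the intersections that belong to the superlevel sets of the
    barycentric coordinates of [x]; the amount of each contraction is
    controlled by the gap in the coordinates at that level. *)
Lemma nerve_map : exists F : |N| -> Y,
  [/\ continuous F,
      forall (Z : topologicalType) (t : Z -> |N|) (y : Z -> Y),
        continuous t -> continuous y ->
        (forall z, inter (carrier (t z)) (y z)) -> homotopic R (F \o t) y &
      forall x i, (forall j, bcoord x j - small_gap < bcoord x i) -> U i (F x)].
Proof.
have /choice[c /choice[H hH]] : forall s : face,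
    exists c : Y, exists H : Y * R -> Y,
    contracts (inter (val s)) c H.
  by move=> s; apply: open_contracts; [exact: open_inter|exact: contrU (valP s)].
pose r (s t : face) := (#|val t| <= #|val s|)%N.
pose L := sort r (enum {: face}).
have rL : pairwise r L.
  rewrite -sorted_pairwise; first by apply: sort_sorted => s t; exact: leq_total.
  by move=> s t u st us; exact: leq_trans us st.
have inL s : s \in L by rewrite mem_sort mem_enum.
have rV x s t : r s t -> 0 <= stage x s -> 0 <= stage x t ->
    inter (val s) `<=` inter (val t).
  by move=> rst xs xt; apply: inter_sub; exact: stage_sub xs xt.
have hL s : s \in L -> contracts (inter (val s)) (c s) (H s) by [].
pose c0 (x : |N|) := c (exist (fun s => s \in faces N) _ (carrier_face x)).
have c0P x : inter (carrier x) (c0 x).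
  by rewrite /c0; have [_ _ _] := hH (exist (fun s => s \in faces N) _ (carrier_face x)).
(* Near each point, some completed stage forgets [c0]. *)
exists (fun x => push H (stage x) L (c0 x)); split=> [x|Z t y ct cy ty|x i xi].
- have [s xs] := stage_near1 x.
  apply: (push_continuous_reset (i := s) hL rL continuous_stage rV) => //.
- apply: homotopic_sym; apply/homotopicP.
  (* At time [0] no parameter is positive, so all stages are switched off. *)
  pose w (p : Z * R) s := stage (t p.1) s - (1 - Num.min p.2 1).
  have w_le p s : w p s <= stage (t p.1) s.
    by rewrite gerBl subr_ge0 ge_min lexx orbT.
  have cw s : continuous (w^~ s).
    move=> q.
    have cs : {for q, continuous (fun p : Z * R => stage (t p.1) s)}.
      apply: (@continuous_comp _ _ _ (t \o fst) (stage^~ s)).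
        by apply: continuous_comp; [exact: cvg_fst|exact: ct].
      exact: continuous_stage.
    have cmin : {for q, continuous (fun p : Z * R => Num.min p.2 1)}.
      by apply: continuous_at_min; [exact: cvg_snd|exact: cst_continuous].
    apply: (continuous_at_sub cs); apply: (continuous_at_sub _ cmin).
    exact: cst_continuous.
  exists (fun p => push H (w p) L (y p.1)); split=> [p|z a a0|z a a1].
  + apply: (push_continuous (V := fun s => inter (val s)) (c := c) (r := r)) => //.
    * by apply: continuous_comp; [exact: cvg_fst|exact: cy].
    * by move=> q s u rsu ws wu; apply: (rV (t q.1)) => //; exact: le_trans (w_le _ _).
    * apply: (@filterE _ (nbhs p)) => q s _ ws; apply: inter_sub (ty q.1).
      by apply: stage_carrier; exact: le_trans (w_le _ _).
  + apply: (push_id hL) => s _; rewrite /w /= min_l ?(le_trans a0) //.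
    by have := stage_le1 (t z) s; lra.
  + have [s /nbhs_singleton xs] := stage_near1 (t z).
    have -> : w (z, a) = stage (t z).
      by apply/funext => u; rewrite /w /= min_r // subrr subr0.
    exact: (push_reset hL _ _ (inL s) xs).
- have [k xk] := exists_bcoord_ge x.
  have xi0 : i \in carrier x.
    rewrite in_carrier; apply: le_lt_trans (xi k).
    by rewrite subr_ge0 (le_trans (ltW (small_gap_lt x))).
  apply: (push_in (P := U i) hL rL (rV x)) => [s _ xs|]; last exact: c0P.
  split; first exact: inter_sub (stage_carrier xs) _ (c0P x).
  move=> y; apply; apply: contraT => nsi.
  have [j sj] := face_neq0 (valP s).
  have [_ /(_ _ nsi)] := stage_ge0 xs sj.
  by have := xi j; lra.
Qed.

End NerveMap.

(** * Maps to the nerve *)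

Section MapsToNerve.
Context {R : realType}.

(** The function is the distance to the complement truncated at [1], expressed
    as a supremum of radii of balls contained in [W]. *)
Lemma open_cozero (T : pseudoMetricType R) (W : set T) : open W ->
  exists f : T -> R,
    [/\ continuous f, forall z, 0 <= f z & forall z, f z != 0 <-> W z].
Proof.
move=> oW.
pose S z := [set e : R | e = 0 \/ [/\ 0 < e, e <= 1 & ball z e `<=` W]].
have S0 z : S z 0 by left.
have S_ub z : ubound (S z) 1 by move=> e [->|[]].
have S_sup z : has_sup (S z) by split; [exists 0|exists 1].
have le_sup z e : S z e -> e <= sup (S z).
  by move=> Se; apply: sup_ubound => //; exists 1.
have lip z z' d : 0 < d -> ball z d z' -> sup (S z) - d <= sup (S z').
  move=> d0 zz'; rewrite lerBlDr; apply: ge_sup; first by exists 0.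
  move=> e Se; have [ed|de] := leP e d.
    by rewrite (le_trans ed) // lerDr (le_sup _ _ (S0 z')).
  case: Se => [e0|[e0 e1 eW]]; first by rewrite e0 ltNge (ltW d0) in de.
  rewrite -lerBlDr; apply: le_sup; right; split; [lra|lra|].
  by move=> u zu; apply: eW; have := ball_triangle zz' zu; rewrite subrKC.
exists (fun z => sup (S z)); split=> [z|z|z]; last 2 first.
- exact: (le_sup _ _ (S0 z)).
- split=> [/eqP supN0|Wz].
    apply: contrapT => nWz; apply: supN0; apply/eqP; rewrite eq_le (le_sup _ _ (S0 z)) andbT.
    apply: ge_sup; first by exists 0.
    by move=> e [->//|[e0 _ eW]]; case: nWz; apply: eW; exact: ballxx.
  have /nbhs_ballP[e /= e0 eW] := open_nbhs_nbhs (conj oW Wz).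
  have min_gt0 : 0 < Num.min e 1 by rewrite lt_min e0 ltr01.
  rewrite gt_eqF //; apply: (lt_le_trans min_gt0); apply: le_sup; right.
  split=> //; first by rewrite ge_min lexx orbT.
  by move=> u zu; apply: eW; apply: le_ball zu; rewrite ge_min lexx.
- apply/cvgrPdist_le => e e0; near=> z'.
  have zz' : ball z e z' by near: z'; exact: nbhsx_ballx.
  have := lip _ _ _ e0 zz'; have := lip _ _ _ e0 (ball_sym zz').
  by rewrite ler_norml; lra.
Unshelve. all: by end_near. Qed.

Context {n : nat} {N : simplicial_complex n}.
Local Notation "|N|" := (realization R N).

(** The map given by a partition of unity subordinate to [W]. *)
Lemma subordinate_map (T : pseudoMetricType R) (W : 'I_n -> set T) :
  (forall i, open (W i)) -> (forall z, exists i, W i z) ->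
  (forall z, exists2 s, s \in faces N & forall i, W i z -> i \in s) ->
  exists f : T -> |N|, continuous f /\
    forall z i, i \in carrier (f z) -> W i z.
Proof.
move=> oW covW faceW.
have /choice[w hw] : forall i, exists f : T -> R,
    [/\ continuous f, forall z, 0 <= f z & forall z, f z != 0 <-> W i z].
  by move=> i; exact: open_cozero.
have wW i z : w i z != 0 <-> W i z by have [_ _] := hw i.
have [||||f [cf _ fE]] := @realization_normalize R n N T (fun z i => w i z).
- by move=> i; have [] := hw i.
- by move=> z i; have [_ + _] := hw i; apply.
- by move=> z; have [i /wW] := covW z; exists i.
- by move=> z; have [s sN sW] := faceW z; exists s => // i /wW /sW.
by exists f; split=> // z i; rewrite fE => /wW.
Qed.

(** The coordinates that are not nearly maximal are dropped. A point [x] and its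
    image share the face [carrier x], so this map is homotopic to the identity,
    and the vertices in the carrier of the image are those [i] for which
    [nerve_map] provides [U i (F x)]. *)
Lemma dominant_map :
  exists psi : |N| -> |N|, continuous psi /\
    forall x i, i \in carrier (psi x) ->
      i \in carrier x /\ forall j, bcoord x j - @small_gap R n < bcoord x i.
Proof.
set d := @small_gap R n; have d0 : 0 < d := small_gap_gt0.
pose m (x : |N|) i : R := \big[Num.min/1]_j (bcoord x i - (bcoord x j - d)).
pose w (x : |N|) i : R := Num.max 0 (m x i).
have w_neq0 x i : (w x i != 0) = (0 < m x i).
  by rewrite /w; case: ltP => [/gt_eqF->|_] //; rewrite eqxx.
have mP x i : 0 < m x i -> forall j, bcoord x j - d < bcoord x i.
  by move=> /bigmin_gtP[_ h] j; rewrite -subr_gt0 h.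
have m_carrier x i : 0 < m x i -> i \in carrier x.
  move=> /mP mi; have [k xk] := exists_bcoord_ge x.
  by rewrite in_carrier; have := mi k; have := small_gap_lt x; rewrite -/d; lra.
have [||||psi [cpsi _ psiE]] := @realization_normalize R n N |N| w.
- move=> i x.
  have cm : {for x, continuous (m^~ i)}.
    apply: continuous_at_bigmin => [|j]; first exact: cst_continuous.
    apply: continuous_at_sub; first exact: continuous_bcoord.
    by apply: continuous_at_sub; [exact: continuous_bcoord|exact: cst_continuous].
  by apply: (continuous_at_max _ cm); exact: cst_continuous.
- by move=> x i; rewrite le_max lexx.
- move=> x; have [i0 _] := carrier_neq0 x.
  have [i _ imax] := @arg_maxP _ _ _ i0 xpredT (bcoord x) isT.
  exists i; rewrite w_neq0; apply/bigmin_gtP; split=> // j _.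
  by have : bcoord x j <= bcoord x i := imax j isT; lra.
- move=> x; exists (carrier x); first exact: carrier_face.
  by move=> i; rewrite w_neq0; exact: m_carrier.
exists psi; split=> // x i; rewrite psiE w_neq0 => mi.
by split; [exact: m_carrier|exact: mP].
Qed.

End MapsToNerve.

(** * The nerve theorem *)

Section NerveTheorem.
Context {R : realType} {n : nat} {Y : topologicalType}.
Variables (U : 'I_n -> set Y) (N : simplicial_complex n).
Local Notation "|N|" := (realization R N).
Hypothesis openU : forall i, open (U i).
Hypothesis coverU : forall y, exists i, U i y.
Hypothesis contrU :
  forall s, s \in faces N -> contractible R (set_type (inter U s)).
Hypothesis nerveN : forall y (s : {set 'I_n}),
  s != finset.set0 -> inter U s y -> s \in faces N.

Lemma exists_face y : exists2 s, s \in faces N & forall i, U i y -> i \in s.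
Proof.
exists [set i | `[< U i y >]]%SET => [|i Ui]; last by rewrite inE; exact/asboolP.
apply: (nerveN (y := y)) => [|i]; last by rewrite inE => /asboolP.
by have [i Ui] := coverU y; apply/set0Pn; exists i; rewrite inE; exact/asboolP.
Qed.

Lemma pullback_map (T : pseudoMetricType R) (f : T -> Y) : continuous f ->
  exists g : T -> |N|, continuous g /\ forall z, inter U (carrier (g z)) (f z).
Proof.
move=> /continuousP cf.
have [|||g [cg gU]] := @subordinate_map R n N T (fun i => f @^-1` U i).
- by move=> i; exact: cf.
- by move=> z; exact: coverU.
- by move=> z; exact: exists_face.
by exists g.
Qed.

(** At each [z], both carriers consist of vertices [i] with [U i (y z)], and all
    these together form a face of the nerve. *)
Lemma inter_homotopic (T : topologicalType) (f g : T -> |N|) (y : T -> Y) :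
  continuous f -> continuous g ->
  (forall z, inter U (carrier (f z)) (y z)) ->
  (forall z, inter U (carrier (g z)) (y z)) -> homotopic R f g.
Proof.
move=> cf cg fy gy; apply: carrier_homotopic => // z.
have [s sN sy] := exists_face (y z); exists s => //.
by split; apply/fintype.subsetP => i ?; apply: sy; [exact: fy|exact: gy].
Qed.

(** Partitions of unity may be missing on [Y]; they are taken on [|K|] and on
    [|N| x R] instead, which are metric. *)
Lemma nerve_theorem m (K : simplicial_complex m) :
  homotopy_equivalent R (realization R K) Y -> homotopy_equivalent R |N| Y.
Proof.
move=> [h [k [ch ck _ hk]]].
have [F [cF Fu FU]] := @nerve_map R n Y U N openU contrU.
have [phi [cphi phih]] := @pullback_map (set_type (@realization_set R m K)) h ch.
pose g := phi \o k.
have cg : continuous g by move=> y; apply: continuous_comp; [exact: ck|exact: cphi].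
have Fg : homotopic R (F \o g) idfun.
  apply: homotopic_trans hk.
  exact: (homotopic_precomp ck (Fu _ phi h cphi ch phih)).
exists F, g; split=> //.
pose a := g \o F.
have ca : continuous a by move=> x; apply: continuous_comp; [exact: cF|exact: cg].
have : homotopic R (F \o a) F := homotopic_precomp cF Fg.
move=> /homotopicP[G [cG G0 G1]].
have [Th [cTh ThG]] :=
  @pullback_map (set_type (@realization_set R n N) * R)%type G cG.
(* The ends of [Th] need not be [a] and the identity, but they are linked to
   [psi \o a] and [psi] by segments, as they follow the same maps to [Y]. *)
have [psi [cpsi psiP]] := @dominant_map R n N.
have cTh0 r : continuous (fun x => Th (x, r)).
  move=> x; apply: (@continuous_comp _ _ _ (fun x => (x, r)) Th); last exact: cTh.
  by apply: continuous_at_pair; [exact: cvg_id|exact: cst_continuous].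
have psi_inter x : inter U (carrier (psi x)) (F x).
  by move=> i /psiP[_]; exact: FU.
have psi_id : homotopic R psi idfun.
  apply: carrier_homotopic => // [y|x]; first exact: cvg_id.
  exists (carrier x); first exact: carrier_face.
  by split; [apply/fintype.subsetP => i /psiP[]|exact: subxx].
apply: (homotopic_trans (g := psi \o a)).
  exact: homotopic_sym (homotopic_precomp ca psi_id).
apply: homotopic_trans psi_id.
apply: (homotopic_trans (g := fun x => Th (x, 0))).
  apply: (inter_homotopic (y := F \o a)) => // [|z|z].
  - by move=> x; apply: continuous_comp; [exact: ca|exact: cpsi].
  - exact: psi_inter.
  - by have := ThG (z, 0); rewrite G0.
apply: (homotopic_trans (g := fun x => Th (x, 1))).
  by exists Th; split=> //; exact: continuous_subspaceT.
apply: (inter_homotopic (y := F)) => // z.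
by have := ThG (z, 1); rewrite G1.
Qed.

End NerveTheorem.

(** * Covering type and number of vertices *)

Section CoverNerve.
Context {R : realType} {Y : topologicalType} {n : nat} (U : 'I_n -> set Y).
Hypothesis U_neq0 : forall i, U i !=set0.

Definition nerve_faces : {set {set 'I_n}} :=
  [set s | (s != finset.set0) && `[< inter U s !=set0 >]]%SET.

Lemma nerve_faces_neq0 : finset.set0 \notin nerve_faces.
Proof. by rewrite inE eqxx. Qed.

Lemma nerve_faces_vertex i : [set i]%SET \in nerve_faces.
Proof.
rewrite inE -card_gt0 cards1; apply/asboolP.
by have [y Uy] := U_neq0 i; exists y => j; rewrite inE => /eqP->.
Qed.

Lemma nerve_faces_down (s t : {set 'I_n}) :
  s \in nerve_faces -> t \subset s -> t != finset.set0 -> t \in nerve_faces.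
Proof.
rewrite !inE => /andP[_ /asboolP[y sy]] ts -> /=.
by apply/asboolP; exists y; exact: inter_sub ts _ sy.
Qed.

Definition nerve : simplicial_complex n :=
  SimplicialComplex nerve_faces_neq0 nerve_faces_vertex nerve_faces_down.

End CoverNerve.

Section CoveringType.
Context {R : realType}.

Lemma good_cover_nerve (Y : topologicalType) (n m : nat) (C : set (set Y))
    (K : simplicial_complex m) :
  good_cover R C -> (C #= `I_n)%card ->
  homotopy_equivalent R (realization R K) Y ->
  exists N : simplicial_complex n,
    homotopy_equivalent R (realization R N) Y.
Proof.
move=> [openC coverC contrC contrFC]; rewrite (card_eqr card_II).
move=> /card_esym/card_bijP[f [f' fK f'K]] KY.
pose U (i : 'I_n) : set Y :=
  val (f (exist (fun i => i \in [set: 'I_n]) i (mem_set I))).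
have UC i : C (U i) by exact: set_mem (valP (f _)).
have U_onto A : C A -> exists i, U i = A.
  move=> CA; pose A' := exist (fun A => A \in C) A (mem_set CA).
  exists (val (f' A')); rewrite /U.
  suff -> : exist (fun i => i \in [set: 'I_n]) (val (f' A')) (mem_set I) = f' A'.
    by rewrite f'K.
  exact: val_inj.
have U_neq0 i : U i !=set0.
  by have [c _] := contrC _ (UC i); exists (val c); exact: set_mem (valP c).
exists (nerve U_neq0); apply: (nerve_theorem (U := U) _ _ _ _ KY).
- by move=> i; exact: openC.
- move=> y; have : (\bigcup_(A in C) A) y by rewrite coverC.
  by move=> [A CA Ay]; have [i iA] := U_onto A CA; exists i; rewrite iA.
- move=> s; rewrite inE => /andP[s0 /asboolP[y sy]].
  have -> : inter U s = \bigcap_(A in U @` [set` s]) A.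
    by rewrite bigcap_image; apply/seteqP; split=> z zs i /zs.
  apply: contrFC.
  - by move=> _ [i _ <-].
  - by apply: finite_image; exact: finite_finset.
  - by have [i si] := set0Pn _ s0; exists (U i); exists i.
  - by exists y => _ [i /sy Uiy <-].
- by move=> y s s0 sy; rewrite inE s0; apply/asboolP; exists y.
Qed.

Lemma min_nat_exists (S : set nat) n : S n ->
  exists2 k, min_nat S = Some k & (k <= n)%N.
Proof.
move=> Sn; rewrite /min_nat; case: pselect => [h|]; last first.
  by case; exists n; exact/mem_set.
by exists (ex_minn h) => //; case: ex_minnP => k _ kmin; exact/kmin/mem_set.
Qed.

Lemma ct_le (X : topologicalType) n (K : simplicial_complex n) :
  homotopy_equivalent R (realization R K) X ->
  exists2 k, ct R X = Some k & (k <= n)%N.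
Proof.
move=> KX; have [C CP] := @open_star_good_cover R n K.
have /min_nat_exists[k sctK kn] : [set n | exists C : set (set (realization R K)),
  good_cover R C /\ (C #= `I_n)%card] n by exists C.
have /min_nat_exists[l ctX lk] : [set n | exists Y : topologicalType,
  homotopy_equivalent R Y X /\ sct R Y = Some n] k by exists (realization R K).
by exists l; rewrite ?(leq_trans lk).
Qed.

Lemma Delta_he_le (X : topologicalType) n (K : simplicial_complex n) :
  homotopy_equivalent R (realization R K) X ->
  exists2 k, Delta_he R X = Some k & (k <= n)%N.
Proof.
move=> KX; have KK : homeomorphic (realization R K) (realization R K).
  by exists id, id; split=> // x; exact: cvg_id.
have /min_nat_exists[k DK kn] : [set n | exists L : simplicial_complex n,
  homeomorphic (realization R L) (realization R K)] n by exists K.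
have /min_nat_exists[l DX lk] : [set n | exists P : topologicalType,
    [/\ compact_polyhedron R P, homotopy_equivalent R P X & Delta R P = Some n]] k.
  by exists (realization R K); split=> //; exists n, K.
by exists l; rewrite ?(leq_trans lk).
Qed.

End CoveringType.

Theorem theorem1p2 (R : realType) (X : topologicalType)
  (hX : exists P : topologicalType,
    compact_polyhedron R P /\ homotopy_equivalent R X P) :
  ct R X = Delta_he R X.
Proof.
have [P [[n [K KP]] XP]] := hX.
have KX : homotopy_equivalent R (realization R K) X.
  apply: homotopy_equivalent_trans (homeomorphic_homotopy_equivalent KP) _.
  exact: homotopy_equivalent_sym.
have [a ctX _] := ct_le KX; have [b DX _] := Delta_he_le KX.
rewrite ctX DX; congr Some; apply/eqP; rewrite eqn_leq; apply/andP; split.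
- have /min_natP[[Q [_ QX DQ]] _] := DX.
  have /min_natP[[L LQ] _] := DQ.
  have LX := homotopy_equivalent_trans (homeomorphic_homotopy_equivalent LQ) QX.
  by have [k] := ct_le LX; rewrite ctX => -[->].
- have /min_natP[[Y [YX sctY]] _] := ctX.
  have /min_natP[[C [gC cC]] _] := sctY.
  have KY := homotopy_equivalent_trans KX (homotopy_equivalent_sym YX).
  have [N NY] := good_cover_nerve gC cC KY.
  by have [k] := Delta_he_le (homotopy_equivalent_trans NY YX); rewrite DX => -[->].
Qed.
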